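(* Let $G$ be a finite graph with a straight-line drawing in the plane, let $k\in\mathbb{N}$, let $v\in V(G)$, and let $\mathbf{e_0}$ be an arc of $G$ with $\mathrm{tail}(\mathbf{e_0})=v$. Run the $k$-neighbourhood exploration algorithm described in the context on input $(G,v,k,\mathbf{e_0})$, and for each iteration $i$ let $(P_i,\mathbf{e_i},mode_i)$ be its state. Then: (a) for every iteration $i$, the subgraph $G[P_i]$ of $G$ induced by $P_i$ is a path whose end-vertices are $v$ and $\mathrm{head}(\mathbf{e_i})$; (b) the states at different iterations are pairwise distinct; (c) the algorithm terminates after a finite number of iterations; (d) for every $u\in N^k[v]=\{u\in V(G): d_G(u,v)\le k\}$ there is an iteration $i$ such that $u\in P_i$.
   Context: A straight-line drawing places the vertices at distinct points of the plane and draws each edge as the straight segment between its endpoints, no edge passing through a vertex other than its endpoints. Each edge $uw$ gives two arcs $(u,w)$ and $(w,u)$; $\mathrm{tail}((u,w))=u$, $\mathrm{head}((u,w))=w$, $\mathrm{rev}((u,w))=(w,u)$. For an arc $\mathbf{e}=(u,w)$, $\mathrm{succ}(\mathbf{e})$ is the first arc $(w,x)$ succeeding $\mathrm{rev}(\mathbf{e})=(w,u)$ in counterclockwise order around $w$. For $S\subseteq V(G)$, $N[S]=S\cup\bigcup_{s\in S}N(s)$ and $N(S)=N[S]\setminus S$; $d_G$ is graph distance. The algorithm uses $k+1$ pebbles, initially all on $v$. At every moment $P$ denotes the set of vertices currently holding at least one pebble; the algorithm also maintains a current arc $\mathbf{e}$ and a $mode\in\{\mathrm{fw},\mathrm{bw}\}$;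 the triple $(P,\mathbf{e},mode)$ is the state. Initialization: keep one pebble on $v$ and move the others to $\mathrm{head}(\mathbf{e_0})$ (so $P=\{v,\mathrm{head}(\mathbf{e_0})\}$), set $\mathbf{e}\leftarrow\mathbf{e_0}$, $mode\leftarrow\mathrm{fw}$. Then repeat the following iteration until $\mathbf{e}=\mathbf{e_0}$: - If $mode=\mathrm{fw}$ and $|P|<k+1$: set $\mathbf{e'}\leftarrow\mathrm{succ}(\mathbf{e})$; while $\mathrm{head}(\mathbf{e'})\in N(P\setminus\{\mathrm{head}(\mathbf{e})\})\setminus P$, set $\mathbf{e'}\leftarrow\mathrm{succ}(\mathrm{rev}(\mathbf{e'}))$; then set $\mathbf{e}\leftarrow\mathbf{e'}$. If $\mathrm{head}(\mathbf{e})\in P$, move all pebbles on $\mathrm{tail}(\mathbf{e})$ to $\mathrm{head}(\mathbf{e})$ and set $mode\leftarrow\mathrm{bw}$; otherwise move all but one of the pebbles on $\mathrm{tail}(\mathbf{e})$ to $\mathrm{head}(\mathbf{e})$. - If $mode=\mathrm{fw}$ and $|P|=k+1$: move all pebbles from $\mathrm{head}(\mathbf{e})$ to $\mathrm{tail}(\mathbf{e})$, set $\mathbf{e}\leftarrow\mathrm{rev}(\mathbf{e})$ and $mode\leftarrow\mathrm{bw}$. - If $mode=\mathrm{bw}$: set $\mathbf{e'}\leftarrow\mathrm{succ}(\mathbf{e})$; while $\mathrm{head}(\mathbf{e'})\in N(P\setminus\{\mathrm{head}(\mathbf{e})\})\setminus P$, set $\mathbf{e'}\leftarrow\mathrm{succ}(\mathrm{rev}(\mathbf{e'}))$;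 then set $\mathbf{e}\leftarrow\mathbf{e'}$. If $\mathbf{e}=\mathbf{e_0}$, move all pebbles to $v$ and terminate. Otherwise, if $\mathrm{head}(\mathbf{e})\in P$, move all pebbles on $\mathrm{tail}(\mathbf{e})$ to $\mathrm{head}(\mathbf{e})$; else move all but one of the pebbles on $\mathrm{tail}(\mathbf{e})$ to $\mathrm{head}(\mathbf{e})$ and set $mode\leftarrow\mathrm{fw}$.
   Formalization: The formal theorem assumes k ≥ 1: for k = 0 there is a single pebble, so the initialization cannot give P = {v, head(e_0)}, and (a) fails for the initial state because P = {v} while head(e_0) ≠ v. *)

(* Defs.v *)
From mathcomp Require Import all_boot all_order all_algebra.
From mathcomp Require Import reals trigo.

Set Implicit Arguments.
Unset Strict Implicit.
Unset Printing Implicit Defensive.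

Import Order.TTheory GRing.Theory Num.Theory.
Local Open Scope ring_scope.

Section Plane.
Variable R : realType.

Definition norm2 (z : R * R) : R := Num.sqrt (z.1 ^+ 2 + z.2 ^+ 2).

(* The polar angle of z <> 0 in [0, 2 pi[ ; see polar_angleP. *)
Definition polar_angle (z : R * R) : R :=
  if 0 <= z.2 then acos (z.1 / norm2 z) else pi *+ 2 - acos (z.1 / norm2 z).

Lemma polar_angleP (z : R * R) : z != 0 ->
  [/\ 0 <= polar_angle z < pi *+ 2,
      z.1 = norm2 z * cos (polar_angle z) &
      z.2 = norm2 z * sin (polar_angle z)].
Proof.
case: z => x y z0; rewrite /polar_angle /norm2 /=.
set n := Num.sqrt _.
have s_gt0 : 0 < x ^+ 2 + y ^+ 2.
  rewrite lt_neqAle addr_ge0 ?sqr_ge0 // andbT eq_sym.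
  rewrite paddr_eq0 ?sqr_ge0 // !sqrf_eq0.
  by apply: contra z0 => /andP[/eqP-> /eqP->].
have n_gt0 : 0 < n by rewrite sqrtr_gt0.
have n2 : n ^+ 2 = x ^+ 2 + y ^+ 2 by rewrite sqr_sqrtr // ltW.
have xB : -1 <= x / n <= 1.
  rewrite -ler_norml normrM normfV (gtr0_norm n_gt0) ler_pdivrMr // mul1r.
  rewrite -(ler_pXn2r (n := 2)) ?nnegrE ?normr_ge0 ?(ltW n_gt0) //.
  by rewrite real_normK ?num_real // n2 lerDl sqr_ge0.
have [/andP[a0 api] cosa] := acos_def xB.
have nx : n * (x / n) = x by rewrite mulrC divfK // gt_eqF.
have nsin : n * sin (acos (x / n)) = `|y|.
  rewrite sin_acos // -{1}(ger0_norm (ltW n_gt0)) -sqrtr_sqr -sqrtrM ?sqr_ge0 //.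
  rewrite mulrBr mulr1 -exprMn nx n2 addrC addKr sqrtr_sqr //.
have pi0 := pi_gt0 R.
have [y0|y0] := leP 0 y.
  split; last by rewrite nsin ger0_norm.
    by rewrite a0 /= (le_lt_trans api) // mulr2n ltrDl.
  by rewrite cosa nx.
rewrite -[pi *+ 2 - _]addrC; split.
- rewrite addrC subr_ge0 (le_trans api) /=; last by rewrite mulr2n lerDl ltW.
  rewrite ltrBlDr ltrDl lt_neqAle a0 andbT eq_sym; apply/eqP => e.
  by move: nsin; rewrite e sin0 mulr0 => /esym/eqP; rewrite normr_eq0 lt_eqF.
- by rewrite mulr2n addrA !cosDpi opprK cosN cosa nx.
- by rewrite mulr2n addrA !sinDpi opprK sinN mulrN nsin ltr0_norm // opprK.
Qed.

Definition on_segment (a b z : R * R) : Prop :=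
  exists2 t : R, 0 <= t <= 1 &
    z.1 = (1 - t) * a.1 + t * b.1 /\ z.2 = (1 - t) * a.2 + t * b.2.

Definition straight_line_drawing (V : finType) (E : rel V) (pos : V -> R * R)
    : Prop :=
  injective pos /\
  forall u w x : V, E u w -> x != u -> x != w ->
    ~ on_segment (pos u) (pos w) (pos x).

End Plane.

Section Graph.
Variables (V : finType) (E : rel V).

Definition closed_nbhd (S : {set V}) : {set V} :=
  S :|: \bigcup_(s in S) [set x | E s x].

Definition open_nbhd (S : {set V}) : {set V} := closed_nbhd S :\: S.

Definition is_walk (u w : V) (s : seq V) : Prop := path E u s /\ last u s = w.

(* d_G(u, w) = d; no such d exists when u and w are not connected. *)
Definition is_dist (u w : V) (d : nat) : Prop :=
  (exists2 s, is_walk u w s & size s = d) /\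
  (forall s, is_walk u w s -> (d <= size s)%N).

Definition in_ball (k : nat) (v u : V) : Prop :=
  exists2 d, is_dist u v d & (d <= k)%N.

Definition induced (P : {set V}) : rel V :=
  fun x y => [&& x \in P, y \in P & E x y].

(* The graph with vertex set P and adjacency F is a path with end-vertices
   a and b; a one-vertex path has a = b. *)
Definition is_path_graph (P : {set V}) (F : rel V) (a b : V) : Prop :=
  exists s : seq V,
    [/\ uniq (a :: s), P =i a :: s, last a s = b &
        forall i j, (i < (size s).+1)%N -> (j < (size s).+1)%N ->
          F (nth a (a :: s) i) (nth a (a :: s) j) = (j == i.+1) || (i == j.+1)].

End Graph.

Section Exploration.
Variables (R : realType) (V : finType) (E : rel V) (pos : V -> R * R).

(* A pair a is an arc of the graph when E a.1 a.2 holds. *)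
Definition arc_type := (V * V)%type.

Definition atail (a : arc_type) : V := a.1.
Definition ahead (a : arc_type) : V := a.2.
Definition arev (a : arc_type) : arc_type := (a.2, a.1).

Definition ccw_nbrs (w : V) : seq V :=
  sort (fun x y => polar_angle (pos x - pos w) <= polar_angle (pos y - pos w))
       (enum [pred x | E w x]).

(* next is the cyclic successor in the list. *)
Definition succ (a : arc_type) : arc_type :=
  (ahead a, next (ccw_nbrs (ahead a)) (atail a)).

Inductive mode := fw | bw.

Record config := Config { pebbles : {ffun V -> nat}; cur : arc_type; cmode : mode }.

Definition occupied (c : {ffun V -> nat}) : {set V} := [set x | (0 < c x)%N].

Definition state (c : config) : {set V} * arc_type * mode :=
  (occupied (pebbles c), cur c, cmode c).

Definition move_pebbles (n : nat) (a b : V) (c : {ffun V -> nat})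
    : {ffun V -> nat} :=
  [ffun x => (c x - n * (x == a) + n * (x == b))%N].

Definition move_all (a b : V) (c : {ffun V -> nat}) : {ffun V -> nat} :=
  move_pebbles (c a) a b c.

Definition move_all_but_one (a b : V) (c : {ffun V -> nat})
    : {ffun V -> nat} :=
  move_pebbles (c a).-1 a b c.

Definition gather (v : V) (c : {ffun V -> nat}) : {ffun V -> nat} :=
  [ffun x => if x == v then (\sum_y c y)%N else 0%N].

(* Result of: while test a do a <- f a. As orbit f a lists a, f a, f (f a), ...
   up to the first repetition, None means that the loop does not terminate. *)
Definition while_loop (T : finType) (test : pred T) (f : T -> T) (a : T)
    : option T :=
  ohead [seq b <- orbit f a | ~~ test b].

Definition next_arc (c : config) : option arc_type :=
  let P := occupied (pebbles c) in
  while_loop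
    (fun a : arc_type =>
       ahead a \in open_nbhd E (P :\ ahead (cur c)) :\: P)
    (fun a => succ (arev a)) (succ (cur c)).

Variables (v : V) (k : nat) (e0 : arc_type).

Definition init_config : config :=
  Config (move_all_but_one v (ahead e0)
            [ffun x => if x == v then k.+1 else 0%N]) e0 fw.

(* One iteration of the main loop; None if an inner loop diverges. In mode fw
   the else branch is the case #|P| = k + 1, as there are k + 1 pebbles. *)
Definition iteration (c : config) : option config :=
  let p := pebbles c in
  let P := occupied p in
  match cmode c with
  | fw =>
      if (#|P| < k.+1)%N then
        omap (fun e =>
          if ahead e \in P then Config (move_all (atail e) (ahead e) p) e bw
          else Config (move_all_but_one (atail e) (ahead e) p) e fw)
          (next_arc c)
      else
        Some (Config (move_all (ahead (cur c)) (atail (cur c)) p)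
                (arev (cur c)) bw)
  | bw =>
      omap (fun e =>
        if e == e0 then Config (gather v p) e bw
        else if ahead e \in P then
          Config (move_all (atail e) (ahead e) p) e bw
        else Config (move_all_but_one (atail e) (ahead e) p) e fw)
        (next_arc c)
  end.

(* run i is the configuration at the beginning of iteration i (counted from 0);
   it is None if iteration i does not take place. The exit test cur = e0 is
   made after an iteration, never before the first one. *)
Fixpoint run (i : nat) : option config :=
  match i with
  | 0 => Some init_config
  | j.+1 =>
      obind (fun c =>
        obind (fun c' => if cur c' == e0 then None else Some c') (iteration c))
        (run j)
  end.

Definition terminates : Prop :=
  exists n c c', [/\ run n = Some c, iteration c = Some c' & cur c' = e0].

End Exploration.

(* Main.v *)
Require Import Defs.
From mathcomp Require Import all_boot all_order all_algebra.
From mathcomp Require Import reals.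
From mathcomp Require Import zify.

Set Implicit Arguments.
Unset Strict Implicit.
Unset Printing Implicit Defensive.

(** Only the cyclic order of the neighbours around each vertex matters.  The
    neighbours of the current end-vertex that the inner loop does not skip are
    the previous vertex of the path and the vertices extending the induced
    path, so the run is the depth-first traversal of the tree of induced paths
    from [v] with at most [k + 1] vertices.  It therefore leaves every subtree
    it enters, and it returns to [e0] once the neighbours of [v] are exhausted.
    A shortest path from [v] is induced, so every vertex of the ball is met.  A
    configuration is determined by its state, so a repeated state would make
    the run periodic. *)

(** * Inner loops as searches for the first iterate failing the test *)

Lemma while_loopP (T : finType) (test : pred T) (f : T -> T) (a : T) (n : nat) :
  ~~ test (iter n f a) ->
  exists m, [/\ while_loop test f a = Some (iter m f a), ~~ test (iter m f a) &
                forall i, i < m -> test (iter i f a)].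
Proof.
move=> tn; have ex : exists n, ~~ test (iter n f a) by exists n.
case: (ex_minnP ex) => m tm m_min; exists m; split => //; last first.
  by move=> i lt_im; apply: contraLR lt_im => /m_min; rewrite -leqNgt.
(* [orbit] is cut at the first repetition; by minimality [m] is at most the [findex] of its own
   iterate, so it falls before the cut. *)
have lt_m : m < order f a.
  have /iter_findex e : fconnect f a (iter m f a) := fconnect_iter f m a.
  apply: leq_ltn_trans (findex_max (fconnect_iter f m a)).
  by apply: m_min; rewrite e.
rewrite /while_loop /orbit -(subnKC (ltnW lt_m)) trajectD filter_cat.
rewrite (_ : [seq b <- traject f a m | _] = [::]).
  case: (order f a - m) (subn_gt0 m (order f a)) => [|d _] /=.
    by rewrite lt_m.
  by rewrite tm.
apply/eqP; rewrite -[_ == _]negbK -has_filter; apply/hasPn => b.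
case/trajectP => i lt_im ->; rewrite negbK; apply: contraLR lt_im => /m_min.
by rewrite -leqNgt.
Qed.

Lemma while_loop_stop (T : finType) (test : pred T) (f : T -> T) (a : T) :
  ~~ test a -> while_loop test f a = Some a.
Proof.
move=> ta; have [m [-> _ tm]] := while_loopP (n := 0) (f := f) ta.
by case: m tm => // m /(_ 0 isT); rewrite /= (negPf ta).
Qed.

(** [orbit f a] and [orbit f (f a)] may be cut at different places, so the two results are compared
    through the minimality of their indices. *)
Lemma while_loop_continue (T : finType) (test : pred T) (f : T -> T) (a : T)
    (n : nat) :
  test a -> ~~ test (iter n f a) ->
  while_loop test f a = while_loop test f (f a).
Proof.
move=> ta tn; have [m [-> tm lt_m]] := while_loopP tn.
case: m tm lt_m => [|m tm lt_m]; first by rewrite /= ta.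
rewrite iterSr in tm; have [p [-> tp lt_p]] := while_loopP tm.
congr Some; rewrite iterSr; case: (ltngtP m p) => [/lt_p|lt_pm|-> //].
  by rewrite (negPf tm).
by have := lt_m p.+1 lt_pm; rewrite iterSr (negPf tp).
Qed.

Lemma mem_cat_cons (T : eqType) (x : T) (s : seq T) :
  x \in s -> exists s1 s2, s = s1 ++ x :: s2.
Proof. by case/path.splitPr => s1 s2; exists s1, s2. Qed.

(** * Induced paths starting at [v] *)

Section Walks.
Variables (V : finType) (E : rel V) (v : V).
Hypothesis E_sym : symmetric E.
Hypothesis E_irr : irreflexive E.

(* Induced paths from v are kept as stacks: the far end-vertex comes first and
   v last. *)
Fixpoint ipath (l : seq V) : bool :=
  match l with
  | [::] => false
  | x :: l' =>
      if l' is z :: _ then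
        [&& ipath l', E z x, x \notin l' & all (fun y => E y x ==> (y == z)) l']
      else x == v
  end.

Lemma ipath_cons x z l : ipath (x :: z :: l) =
  [&& ipath (z :: l), E z x, x \notin z :: l &
      all (fun y => E y x ==> (y == z)) (z :: l)].
Proof. by []. Qed.

Lemma ipath_uniq l : ipath l -> uniq l.
Proof.
elim: l => // x [//|z l] IH; rewrite ipath_cons => /and4P[/IH ul _ xl _].
by rewrite cons_uniq xl.
Qed.

Lemma ipath_last x0 l : ipath l -> last x0 l = v.
Proof.
elim: l x0 => // x [|z l] IH x0; first by move/eqP.
by rewrite ipath_cons => /and4P[/IH e _ _ _]; apply: e.
Qed.

Lemma ipath_bottom l : ipath l -> v \in l.
Proof.
by case: l => // x l /(ipath_last x) /= e; rewrite -{1}e mem_last.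
Qed.

Lemma ipath_suffix q x l : ipath (q ++ x :: l) -> ipath (x :: l).
Proof.
elim: q => // y q IH; rewrite cat_cons.
case: q IH => [|z q] IH; first by rewrite cat0s ipath_cons => /and4P[].
by rewrite cat_cons ipath_cons => /and4P[ip _ _ _]; apply: IH.
Qed.

(** Hence an arc from the end-vertex back into [P] can only retrace the last edge of the path. *)
Lemma ipath_top_nbr x z l y :
  ipath (x :: z :: l) -> y \in x :: z :: l -> E x y -> y = z.
Proof.
rewrite ipath_cons => /and4P[_ _ _ /allP al]; rewrite in_cons => /orP[/eqP->|].
  by rewrite E_irr.
by move/al; rewrite E_sym => /implyP h /h /eqP.
Qed.

Lemma ipath_nth l i j : ipath l -> i < size l -> j < size l ->
  E (nth v l i) (nth v l j) = (j == i.+1) || (i == j.+1).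
Proof.
have top x z t m : ipath (x :: z :: t) -> m < size (z :: t) ->
    E x (nth v (z :: t) m) = (m == 0).
  move=> ip lt_m; apply/idP/eqP => [e|->]; last first.
    by move: ip; rewrite ipath_cons E_sym => /and4P[].
  have inm : nth v (z :: t) m \in x :: z :: t by rewrite in_cons mem_nth ?orbT.
  have /eqP := ipath_top_nbr ip inm e.
  have /ipath_uniq : ipath (z :: t) by move: ip; rewrite ipath_cons => /and4P[].
  by move=> uz; rewrite -[X in _ == X]/(nth v (z :: t) 0) nth_uniq // => /eqP.
elim: l i j => // x [_|z l IH] i j ip.
  by case: i j => [|i] [|j] //=; rewrite E_irr.
have ip' : ipath (z :: l) by move: ip; rewrite ipath_cons => /and4P[].
case: i j => [|i] [|j]; rewrite ?[nth v (x :: _) _]/= => lti ltj.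
- by rewrite E_irr.
- by rewrite (top _ _ _ _ ip ltj) orbF eqSS.
- by rewrite E_sym (top _ _ _ _ ip lti) eqSS.
by rewrite (IH i j) // !eqSS.
Qed.

Lemma ipath_is_path_graph l : ipath l ->
  is_path_graph [set x in l] (induced E [set x in l]) v (head v l).
Proof.
move=> ip; case/lastP: l ip => // l x ip.
have := ipath_last v ip; rewrite last_rcons => ex; subst x.
have erev : v :: rev l = rev (rcons l v) by rewrite rev_rcons.
have esz : (size (rev l)).+1 = size (rcons l v) by rewrite size_rev size_rcons.
exists (rev l); split.
- by rewrite erev rev_uniq ipath_uniq.
- by move=> x; rewrite inE erev mem_rev.
- rewrite -[last v (rev l)]/(last v (v :: rev l)) erev.
  by case: (rcons l v) => // y t; rewrite rev_cons last_rcons.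
rewrite erev esz => i j lti ltj; rewrite /induced !inE -!(mem_rev (rcons l v)).
rewrite !mem_nth ?size_rev //= !nth_rev // ipath_nth //; first last.
- by rewrite ltn_subrL (leq_ltn_trans _ ltj).
- by rewrite ltn_subrL (leq_ltn_trans _ lti).
(* Reversal sends index [i] to the size minus [i.+1], which exchanges the two disjuncts. *)
by apply/idP/idP => /orP[] /eqP h; apply/orP; [right|left|right|left];
   apply/eqP; lia.
Qed.

(** A repeated vertex or a chord would give a shorter walk. Walks run from [u] to [v], so [u :: s]
    already has [v] at the bottom. *)
Lemma shortest_walk_ipath u s : is_walk E u v s ->
  (forall t, is_walk E u v t -> size s <= size t) -> ipath (u :: s).
Proof.
elim: s u => [|x s IH] u [pu lu] smin; first exact/eqP.
have /andP[Eux px] : E u x && path E x s := pu.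
have suffix_walk s1 y s2 : x :: s = s1 ++ y :: s2 -> is_walk E y v s2.
  move=> e; split; first by move: pu; rewrite e cat_path /= => /and3P[].
  by move: lu; rewrite e last_cat.
rewrite ipath_cons; apply/and4P; split.
- apply: IH => // t [pt lt].
  by rewrite -ltnS; apply: (smin (x :: t)); split; rewrite //= Eux.
- by rewrite E_sym.
- apply/negP => /mem_cat_cons[s1 [s2 e]]; have := smin _ (suffix_walk _ _ _ e).
  by rewrite e size_cat /=; lia.
apply/allP => y ys; apply/implyP => Eyu; apply/eqP.
move: ys; rewrite in_cons => /orP[/eqP //|/mem_cat_cons[s1 [s2 e]]].
have [p2 l2] := suffix_walk (x :: s1) y s2 (congr1 (cons x) e).
have := smin (y :: s2); rewrite e /= size_cat /= => h.
suff : (size s1 + (size s2).+1).+1 <= (size s2).+1 by lia.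
by apply: h; split; rewrite //= E_sym Eyu.
Qed.

End Walks.

(** * Rotation order and configurations carried by an induced path *)

Section Exploration.
Variables (R : realType) (V : finType) (E : rel V) (pos : V -> R * R).
Variables (v : V) (k : nat) (e0 : arc_type V).
Hypothesis E_sym : symmetric E.
Hypothesis E_irr : irreflexive E.
Hypothesis k_gt0 : 0 < k.
Hypothesis e0_arc : E (atail e0) (ahead e0).
Hypothesis e0_tail : atail e0 = v.

Local Notation nbrs := (ccw_nbrs E pos).
Local Notation run := (run E pos v k e0).
Local Notation iteration := (iteration E pos v k e0).
Local Notation next_arc := (next_arc E pos).
Local Notation ipath := (ipath E v).

Lemma mem_nbrs x y : (y \in nbrs x) = E x y.
Proof. by rewrite mem_sort mem_enum inE. Qed.

Lemma nbrs_uniq x : uniq (nbrs x).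
Proof. by rewrite sort_uniq enum_uniq. Qed.

Lemma next_nbrs x y : E x y -> E x (next (nbrs x) y).
Proof. by rewrite -!mem_nbrs mem_next. Qed.

Definition stack_pebbles (l : seq V) : {ffun V -> nat} :=
  [ffun x => (x \in l) + (k.+1 - size l) * (x == head v l)].

(** The tail [a] of the current arc is, in the run, the previous vertex of the path in mode [fw] and
    the vertex just abandoned in mode [bw]. *)
Definition conf (l : seq V) (a : V) (md : mode) : config V :=
  Config (stack_pebbles l) (a, head v l) md.

Lemma occupied_stack l : ipath l -> occupied (stack_pebbles l) = [set x in l].
Proof.
case: l => // x l _; apply/setP => y; rewrite !inE ffunE /= in_cons.
by case: (y == x) => //=; case: (y \in l); rewrite // muln0.
Qed.

(** The bounds here and in [push_pebbles] keep the truncated subtraction exact; a push needs a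
    pebble beyond the one left behind, whence [k] there. *)
Lemma pop_pebbles x z l : uniq (x :: z :: l) -> size (x :: z :: l) <= k.+1 ->
  move_all x z (stack_pebbles (x :: z :: l)) = stack_pebbles (z :: l).
Proof.
rewrite /= !in_cons negb_or => /and3P[/andP[xz xl] zl _] sz.
apply/ffunP => y; rewrite !ffunE /= !in_cons eqxx.
case: (eqVneq y x) => [->|yx]; first by rewrite (negPf xz) (negPf xl); lia.
by case: (eqVneq y z) => [_|_] /=; case: (y \in l); lia.
Qed.

Lemma push_pebbles x y l : uniq (y :: x :: l) -> size (x :: l) <= k ->
  move_all_but_one x y (stack_pebbles (x :: l)) = stack_pebbles (y :: x :: l).
Proof.
rewrite /= !in_cons negb_or => /and3P[/andP[yx yl] xl _] sz.
apply/ffunP => t; rewrite !ffunE /= !in_cons eqxx (negPf xl).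
case: (eqVneq t y) => [->|ty]; first by rewrite (negPf yx) (negPf yl); lia.
case: (eqVneq t x) => [->|_] /=; first by lia.
by case: (t \in l); lia.
Qed.

(** * The inner loop: rotation past neighbours that would create a chord *)

Definition skip (l : seq V) (y : V) : bool :=
  y \in open_nbhd E ([set x in l] :\ head v l) :\: [set x in l].

Lemma skipE x l y : uniq (x :: l) ->
  skip (x :: l) y = (y \notin x :: l) && has (fun s => E s y) l.
Proof.
move=> /= /andP[xl _]; rewrite /skip /open_nbhd /closed_nbhd.
have -> : [set t in x :: l] :\ head v (x :: l) = [set t in l].
  apply/setP => t; rewrite !inE /=; case: eqVneq => //= ->.
  by rewrite (negPf xl).
rewrite in_setD in_set; case ynl: (y \notin _) => //=.
move: ynl; rewrite in_cons negb_or => /andP[_ yl].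
rewrite !in_setD in_setU !in_set (negPf yl) /=.
apply/bigcupP/hasP => [[s]|[s sl Esy]]; first by rewrite !in_set; exists s.
by exists s; rewrite in_set.
Qed.

(** For a neighbour of the end-vertex off the path, the test of the inner loop looks for an
    adjacency with an earlier vertex, that is, for a chord of the extended path. *)
Lemma ipath_extend l y : ipath l -> E (head v l) y -> y \notin l ->
  ipath (y :: l) = ~~ skip l y.
Proof.
case: l => // x l ip Exy yl; rewrite (skipE _ (ipath_uniq ip)) yl ipath_cons.
rewrite ip yl [E x y]Exy /= eqxx implybT /= -all_predC.
apply: eq_in_all => t tl /=; have /= /andP[xl _] := ipath_uniq ip.
by rewrite (_ : (t == x) = false) ?implybF //; apply: contraNF xl => /eqP <-.
Qed.

Lemma next_arc_confE l a md : ipath l ->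
  next_arc (conf l a md) =
  while_loop (fun b : arc_type V => skip l (ahead b))
    (fun b => succ E pos (arev b)) (head v l, next (nbrs (head v l)) a).
Proof. by move=> ip; rewrite /next_arc /= occupied_stack. Qed.

Lemma iter_turn x y n :
  iter n (fun b => succ E pos (arev b)) (x, y) =
  (x, iter n (next (nbrs x)) y).
Proof. by elim: n => //= n ->. Qed.

(** Rotation meets every neighbour, among them the previous vertex of the path, which lies in [P]
    and is never skipped; on a one-vertex path nothing is skipped. *)
Lemma skip_stops l a : ipath l -> E (head v l) a ->
  exists n, ~~ skip l (iter n (next (nbrs (head v l))) a).
Proof.
case: l => [//|x [|z l]] ip Exa.
  by exists 0; rewrite skipE ?andbF.
have Exz : E x z by move: ip; rewrite ipath_cons E_sym => /and4P[].
have co : fconnect (next (nbrs x)) a z.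
  by rewrite (fconnect_cycle (cycle_next (nbrs_uniq x))) mem_nbrs.
exists (findex (next (nbrs x)) a z); rewrite iter_findex //.
by rewrite (skipE _ (ipath_uniq ip)) !in_cons eqxx orbT.
Qed.

Lemma next_arcP l a md : ipath l -> E (head v l) a ->
  exists y, [/\ next_arc (conf l a md) = Some (head v l, y),
                E (head v l) y & ~~ skip l y].
Proof.
move=> ip Ea; set x := head v l in Ea *.
have [n sn] := skip_stops ip (next_nbrs Ea).
have [|m [e sm _]] := while_loopP (a := (x, next (nbrs x) a)) (n := n)
    (test := fun b : arc_type V => skip l (ahead b))
    (f := fun b => succ E pos (arev b)); first by rewrite iter_turn.
rewrite next_arc_confE // e iter_turn in sm *.
exists (iter m (next (nbrs x)) (next (nbrs x) a)); split => //.
by elim: {e sm} m => [|m IH] /=; apply: next_nbrs.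
Qed.

Lemma next_arc_stop l a md : ipath l ->
  ~~ skip l (next (nbrs (head v l)) a) ->
  next_arc (conf l a md) = Some (head v l, next (nbrs (head v l)) a).
Proof. by move=> ip sk; rewrite next_arc_confE // while_loop_stop. Qed.

(** A skipped neighbour can stand in for the tail of the current arc, so the traversal may be
    followed one neighbour at a time. *)
Lemma next_arc_skip l a md : ipath l -> E (head v l) a ->
  skip l (next (nbrs (head v l)) a) ->
  next_arc (conf l a md) = next_arc (conf l (next (nbrs (head v l)) a) md).
Proof.
move=> ip Ea sk; have [n sn] := skip_stops ip (next_nbrs Ea).
by rewrite !next_arc_confE // (while_loop_continue (n := n)) // iter_turn.
Qed.

(** * One iteration as a push or a pop *)

Definition turn (l : seq V) (y : V) : config V :=
  if y \in l then conf (behead l) (head v l) bw else conf (y :: l) (head v l) fw.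

Definition step (c : config V) : option (config V) :=
  obind (fun c' => if cur c' == e0 then None else Some c') (iteration c).

(** With a pebble to spare both modes act alike, and in mode [fw] the exit test catches [e0]
    afterwards. As [next_arc] does not read the mode, [bw] on the right serves for both. *)
Lemma step_turn l a md : ipath l -> size l <= k -> E (head v l) a ->
  step (conf l a md) =
  obind (fun e => if e == e0 then None else Some (turn l (ahead e)))
        (next_arc (conf l a bw)).
Proof.
move=> ip sz Ea; have [y [e Ey sk]] := next_arcP bw ip Ea.
rewrite e /= /step /iteration.
have -> : next_arc (conf l a md) = Some (head v l, y) by rewrite -e.
rewrite /= occupied_stack //.
have -> : #|[set x in l]| < k.+1.
  by rewrite ltnS (leq_trans _ sz) // cardsE card_size.
rewrite /turn in_set.
have turnE : (if y \in l
    then Config (move_all (head v l) y (stack_pebbles l)) (head v l, y) bw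
    else Config (move_all_but_one (head v l) y (stack_pebbles l))
           (head v l, y) fw) =
    turn l y.
  rewrite /turn; case: ifPn => yl.
    case: l ip sz Ea Ey yl {e sk} => [//|x [|z l]] ip sz _ Exy yl.
      by move: yl Exy; rewrite inE => /eqP ->; rewrite E_irr.
    have -> := ipath_top_nbr E_sym E_irr ip yl Exy.
    by rewrite pop_pebbles ?(ipath_uniq ip) // ltnW.
  have ip' : ipath (y :: l) by rewrite ipath_extend.
  case: l ip sz Ea Ey yl {e sk} ip' => [//|x l] ip sz _ _ _ ip'.
  by rewrite push_pebbles ?(ipath_uniq ip').
rewrite /turn in turnE.
have curE : cur (if y \in l then conf (behead l) (head v l) bw
                 else conf (y :: l) (head v l) fw) = (head v l, y).
  by rewrite -turnE; case: ifP.
case: md; rewrite /= /atail /ahead /= ?turnE; first by rewrite curE.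
by case: (boolP ((head v l, y) == e0)) => /= [->|/negPf ne]; rewrite ?curE ?ne.
Qed.

Lemma step_bounce x z l : ipath (x :: z :: l) -> size (x :: z :: l) = k.+1 ->
  step (conf (x :: z :: l) z fw) = Some (conf (z :: l) x bw).
Proof.
move=> ip sz; rewrite /step /iteration [cmode _]/= [pebbles _]/=.
rewrite occupied_stack // cardsE (card_uniqP (ipath_uniq ip)) sz ltnn /=.
rewrite /arev /atail /ahead /= pop_pebbles ?(ipath_uniq ip) ?sz //.
(* The reversed arc leaves [x], whereas [e0] leaves [v], which lies strictly below [x] in the
   stack. *)
case: eqP => // e; have /= /andP[] := ipath_uniq ip.
move: e0_tail; rewrite -e /atail /= => -> /negP[].
by apply: (@ipath_bottom _ E); move: ip; rewrite ipath_cons => /and4P[].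
Qed.

(** In mode [bw] a vertex has just been given up, hence the bound [k]; of [a] only adjacency
    matters, as rotation resumes from it. *)
Inductive well_formed : config V -> Prop :=
| wf_fw x z l : ipath (x :: z :: l) -> size (x :: z :: l) <= k.+1 ->
    well_formed (conf (x :: z :: l) z fw)
| wf_bw l a : ipath l -> size l <= k -> E (head v l) a ->
    well_formed (conf l a bw).

Lemma wf_turn l y : ipath l -> size l <= k -> E (head v l) y ->
  ~~ skip l y -> well_formed (turn l y).
Proof.
case: l => // x l ip sz Exy sk; rewrite /turn; case: ifPn => yl.
  case: l ip sz Exy sk yl => [|z l] ip sz Exy sk yl.
    by move: yl Exy; rewrite inE => /eqP ->; rewrite E_irr.
  apply: wf_bw; [|exact: ltnW|];
    by move: ip; rewrite ipath_cons => /and4P[].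
by apply: wf_fw => //; rewrite ipath_extend.
Qed.

Lemma wf_step c c' : well_formed c -> step c = Some c' -> well_formed c'.
Proof.
have aux l a md : ipath l -> size l <= k -> E (head v l) a ->
    step (conf l a md) = Some c' -> well_formed c'.
  move=> ip sz Ea; rewrite step_turn //.
  have [y [-> Ey sk]] := next_arcP bw ip Ea; rewrite /=.
  by case: eqP => // _ [<-]; apply: wf_turn.
case=> [x z l ip|l a]; last exact: aux.
have Exz : E x z by move: ip; rewrite ipath_cons E_sym => /and4P[].
rewrite leq_eqVlt => /orP[/eqP sz|sz]; last exact: aux.
rewrite step_bounce // => -[<-]; move: (ip); rewrite ipath_cons.
by case/and4P=> ip' Ezx _ _; apply: wf_bw => //; rewrite -ltnS -sz.
Qed.

Lemma runS i : run i.+1 = obind step (run i).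
Proof. by []. Qed.

Lemma init_confE : init_config v k e0 = conf [:: ahead e0; v] v fw.
Proof.
have hv : ahead e0 != v.
  by apply: contraTneq e0_arc => ->; rewrite e0_tail E_irr.
(* The initial placement is a push onto [[:: v]], whose only vertex carries all [k.+1] pebbles. *)
rewrite /init_config /conf -push_pebbles //=; last by rewrite inE hv.
have -> : (v, ahead e0) = e0.
  by rewrite -e0_tail /atail /ahead -surjective_pairing.
congr (Config (move_all_but_one _ _ _)); apply/ffunP => x.
by rewrite !ffunE /= inE; case: (x == v); lia.
Qed.

Lemma wf_init : well_formed (init_config v k e0).
Proof.
have hv : ahead e0 != v.
  by apply: contraTneq e0_arc => ->; rewrite e0_tail E_irr.
rewrite init_confE; apply: wf_fw; last by rewrite /= !ltnS.
rewrite ipath_cons inE hv /= !eqxx implybT -{1}e0_tail.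
by rewrite e0_arc.
Qed.

Lemma wf_run i c : run i = Some c -> well_formed c.
Proof.
elim: i c => [|i IH] c; first by move=> [<-]; apply: wf_init.
rewrite runS; case e: (run i) => [d|//] /=; apply: wf_step; exact: IH.
Qed.

Lemma wf_stack c : well_formed c ->
  exists l, [/\ ipath l, pebbles c = stack_pebbles l & ahead (cur c) = head v l].
Proof.
by case=> [x z l|l a] ip *; [exists (x :: z :: l)|exists l].
Qed.

(* The pebble counts are determined by the occupied set and the end-vertex. *)
Lemma wf_state_inj c c' : well_formed c -> well_formed c' ->
  state c = state c' -> c = c'.
Proof.
move=> /wf_stack[l [ip pl hl]] /wf_stack[l' [ip' pl' hl']].
case: c c' pl hl pl' hl' => p e m [p' e' m'] /= -> hl -> hl' [].
rewrite !occupied_stack // => /setP el ee em; subst e' m'; congr Config.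
apply/ffunP => x; rewrite !ffunE -hl -hl'.
have mem_l : l =i l' by move=> y; have := el y; rewrite !in_set.
rewrite mem_l; congr (_ + (_ - _) * _).
rewrite -(card_uniqP (ipath_uniq ip)) -(card_uniqP (ipath_uniq ip')).
exact: eq_card.
Qed.

(** * Depth-first traversal, coverage and termination *)

Definition visited (c : config V) : Prop := exists i, run i = Some c.

Lemma visited_step c c' : visited c -> step c = Some c' -> visited c'.
Proof. by case=> i ri sc; exists i.+1; rewrite runS ri. Qed.

Definition covered (l : seq V) : Prop :=
  exists2 c, visited c & pebbles c = stack_pebbles l.

(* Depth-first search: the run enters the subtree of induced paths extending
   x :: z :: l, exhausts it, and leaves it by the arc (x, z). *)
Lemma explore x z l : ipath (x :: z :: l) -> size (x :: z :: l) <= k.+1 ->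
  visited (conf (x :: z :: l) z fw) ->
  visited (conf (z :: l) x bw) /\
  forall q, ipath (q ++ x :: z :: l) -> size (q ++ x :: z :: l) <= k.+1 ->
    covered (q ++ x :: z :: l).
Proof.
(* Induction on the number of vertices that can still be pushed. *)
have [n] := ubnP (k.+1 - size (x :: z :: l)).
elim: n x z l => // n IHn x z l; set L := x :: z :: l.
rewrite ltnS => le_n ip szL visL.
have Exz : E x z by move: ip; rewrite ipath_cons E_sym => /and4P[].
have xv : x != v.
  have /= /andP[xl _] := ipath_uniq ip; apply: contraNneq xl => ->.
  by apply: (@ipath_bottom _ E); move: ip; rewrite ipath_cons => /and4P[].
move: szL; rewrite leq_eqVlt => /orP[/eqP szL|szL].
  split; first by apply: visited_step visL _; rewrite step_bounce.
  case=> [_ _|y q _]; first by exists (conf L z fw).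
  by rewrite size_cat szL /=; lia.
(* The run cannot exit while rotating around a vertex other than [v]. *)
have not_e0 y : ((x, y) == e0) = false.
  by apply: contraNF xv => /eqP e; rewrite -e0_tail -e.
(* Listed from [z] on, the other neighbours [r] come in the order of the rotation, which closes up
   at [z]. *)
have [i r rotE] : rot_to_spec (nbrs x) z by apply: rot_to; rewrite mem_nbrs.
have nextE : next (nbrs x) =1 next (z :: r).
  by move=> y; rewrite -rotE next_rot // nbrs_uniq.
have mem_r y : (y \in z :: r) = E x y by rewrite -rotE mem_rot mem_nbrs.
have ur : uniq (z :: r) by rewrite -rotE rot_uniq nbrs_uniq.
(* Rotation around x, from the neighbour preceding r2 back to z.  Only the
   successor of the current configuration is required to be visited, since
   the neighbours that are skipped never become current. *)
suff rotate r1 r2 : r = r1 ++ r2 ->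
    (forall c, step (conf L (last z r1) bw) = Some c -> visited c) ->
    visited (conf (z :: l) x bw) /\
    forall q y, y \in r2 -> ipath (q ++ y :: L) ->
      size (q ++ y :: L) <= k.+1 -> covered (q ++ y :: L).
  have [|vis cov] := rotate [::] r erefl.
    (* By [step_turn] the forward visit of [L] has the same successor as the backward configuration
       with tail [z]. *)
    by move=> c sc; apply: visited_step visL _; rewrite step_turn // -sc step_turn.
  split=> // q; case/lastP: q => [_ _|q y]; first by exists (conf L z fw).
  rewrite cat_rcons => ipq; apply: cov => //.
  have := ipath_suffix ipq; rewrite ipath_cons => /and4P[_ Exy].
  rewrite !in_cons !negb_or => /and3P[_ yz _] _.
  by have := mem_r y; rewrite Exy in_cons (negPf yz).
elim: r2 r1 => [|y r2 IH] r1 er vis.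
  have nz : next (nbrs x) (last z r1) = z.
    rewrite nextE er cats0; apply/eqP.
    have := cycle_next ur; rewrite er cats0 /= rcons_path.
    by case/andP.
  split=> //; apply: vis; rewrite step_turn //; last first.
    by rewrite /= -mem_r er cats0 mem_last.
  rewrite next_arc_stop //= nz ?not_e0 ?(skipE _ (ipath_uniq ip)).
    by rewrite /turn !in_cons eqxx orbT.
  by rewrite !in_cons eqxx orbT.
have ny : next (nbrs x) (last z r1) = y.
  rewrite nextE er; apply/eqP.
  have := cycle_next ur; rewrite er /= rcons_path cat_path /=.
  by case/andP=> /and3P[].
have Ela : E x (last z r1).
  by rewrite -mem_r er -cat_cons mem_cat mem_last.
have Exy : E x y by rewrite -mem_r er in_cons mem_cat in_cons eqxx !orbT.
have yz : y != z.
  by apply: contraTneq ur => <-; rewrite er /= mem_cat in_cons eqxx orbT.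
have yL : y \notin L.
  by apply: contra yz => yL; apply/eqP/(ipath_top_nbr E_sym E_irr ip).
have er' : r = rcons r1 y ++ r2 by rewrite cat_rcons.
(* If [y] is skipped, no induced path has [y :: L] as its lower part. Otherwise the outer induction
   explores the subtree of [y :: L] and comes back with tail [y]. *)
case sk: (skip L y).
  have [|v1 v2] := IH (rcons r1 y) er'.
    move=> c; rewrite last_rcons => sc; apply: vis; rewrite -sc !step_turn //=.
    by rewrite next_arc_skip ?ny.
  split=> // q t; rewrite in_cons => /orP[/eqP->|]; last exact: v2.
  by move=> /ipath_suffix; rewrite ipath_extend ?sk.
have ipy : ipath (y :: L) by rewrite ipath_extend ?sk.
have visy : visited (conf (y :: L) x fw).
  apply: vis; rewrite step_turn // next_arc_stop //= ny ?sk //.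
  by rewrite not_e0 /turn (negPf yL).
have lt_n : k.+1 - size (y :: L) < n by rewrite /= in le_n szL *; lia.
have [visb covy] := IHn _ _ _ lt_n ipy szL visy.
have [|v1 v2] := IH (rcons r1 y) er'.
  by move=> c; rewrite last_rcons; apply: visited_step.
split=> // q t; rewrite in_cons => /orP[/eqP->|]; [exact: covy|exact: v2].
Qed.

(** At the root nothing is skipped, so every neighbour of [v] is entered in turn; after the last one
    the rotation returns to the head of [e0], which triggers the exit. *)
Lemma run_terminates_and_covers :
  terminates E pos v k e0 /\
  forall l, ipath l -> size l <= k.+1 -> covered l.
Proof.
set h := ahead e0.
have e0E : e0 = (v, h) 
  by rewrite -e0_tail /h /atail /ahead -surjective_pairing.
have vis0 : visited (conf [:: h; v] v fw) by exists 0; rewrite /= init_confE.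
have Evh : E v h by rewrite -e0_tail.
have hv : h != v by apply: contraTneq Evh => ->; rewrite E_irr.
have ipv : ipath [:: v] by rewrite /= eqxx.
have ext y : E v y -> ipath [:: y; v].
  move=> Evy; rewrite ipath_extend ?skipE ?andbF // inE.
  by apply: contraTneq Evy => ->; rewrite E_irr.
have sz2 y : size [:: y; v] <= k.+1 by rewrite ltnS.
have [i r rotE] : rot_to_spec (nbrs v) h by apply: rot_to; rewrite mem_nbrs.
have nextE : next (nbrs v) =1 next (h :: r).
  by move=> y; rewrite -rotE next_rot // nbrs_uniq.
have mem_r y : (y \in h :: r) = E v y by rewrite -rotE mem_rot mem_nbrs.
have ur : uniq (h :: r) by rewrite -rotE rot_uniq nbrs_uniq.
have [visb covh] := explore (ext h Evh) (sz2 h) vis0.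
(* Unlike in [explore], the configuration itself has to be visited: the last one witnesses
   termination. *)
suff rotate r1 r2 : r = r1 ++ r2 -> visited (conf [:: v] (last h r1) bw) ->
    terminates E pos v k e0 /\
    forall q y, y \in r2 -> ipath (q ++ [:: y; v]) ->
      size (q ++ [:: y; v]) <= k.+1 -> covered (q ++ [:: y; v]).
  have [term cov] := rotate [::] r erefl visb; split=> // l.
  case/lastP: l => // l x ip; have := ipath_last v ip.
  rewrite last_rcons => ex; subst x; case/lastP: l ip => [_ _|q y].
    (* The path reduced to [v] is held on return from the first subtree. *)
    exists (conf [:: v] h bw) => //.
  rewrite -!cats1 -catA /= => ipq szq.
  have := ipath_suffix ipq; rewrite ipath_cons => /and4P[_ Evy _ _].
  by move: Evy; rewrite -mem_r in_cons => /orP[/eqP ey|yr];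
    [move: ipq szq; rewrite ey; apply: covh | apply: cov].
elim: r2 r1 => [|y r2 IH] r1 er vis.
  have nh : next (nbrs v) (last h r1) = h.
    rewrite nextE er cats0; apply/eqP.
    have := cycle_next ur; rewrite er cats0 /= rcons_path.
    by case/andP.
  split=> //; case: vis => n rn.
  exists n, (conf [:: v] (last h r1) bw).
  exists (Config (gather v (stack_pebbles [:: v])) e0 bw); split=> //.
  rewrite /iteration /= next_arc_stop ?skipE ?andbF //= nh.
  by rewrite -e0E eqxx.
have ny : next (nbrs v) (last h r1) = y.
  rewrite nextE er; apply/eqP.
  have := cycle_next ur; rewrite er /= rcons_path cat_path /=.
  by case/andP=> /and3P[].
have Ela : E v (last h r1).
  by rewrite -mem_r er -cat_cons mem_cat mem_last.
have Evy : E v y by rewrite -mem_r er in_cons mem_cat in_cons eqxx !orbT.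
have yh : y != h.
  by apply: contraTneq ur => <-; rewrite er /= mem_cat in_cons eqxx orbT.
have visy : visited (conf [:: y; v] v fw).
  apply: visited_step vis _.
  rewrite step_turn // next_arc_stop ?skipE ?andbF //= ny e0E.
  rewrite xpair_eqE (negPf yh) andbF /turn inE.
  by rewrite (_ : (y == v) = false) //; apply: contraTF Evy => /eqP->; rewrite E_irr.
have [visy' covy] := explore (ext y Evy) (sz2 y) visy.
have [||term cov] := IH (rcons r1 y); rewrite ?cat_rcons ?last_rcons //.
split=> // q t; rewrite in_cons => /orP[/eqP->|]; [exact: covy|exact: cov].
Qed.

(** * No configuration recurs *)

Lemma run_addn i j n : run i = run j -> run (i + n) = run (j + n).
Proof. by move=> e; elim: n => [|n IH]; rewrite ?addn0 // !addnS !runS IH. Qed.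

Lemma run_le_Some i j c : run j = Some c -> i <= j -> exists c', run i = Some c'.
Proof.
elim: j c => [|j IH] c rj; first by rewrite leqn0 => /eqP->; exists c.
rewrite leq_eqVlt => /orP[/eqP->|]; first by exists c.
by move: rj; rewrite runS; case e: (run j) => [d|//] _; apply: IH e.
Qed.

(** If configurations [i < j] agree, the end of the run at [n.+1] is shifted back by [j - i], to an
    index at most [n], where the run is still going. *)
Lemma run_inj i j c : terminates E pos v k e0 ->
  run i = Some c -> run j = Some c -> i = j.
Proof.
case=> n [d [d' [rn itd cd]]].
have rSn : run n.+1 = None by rewrite runS rn /= /step itd /= cd eqxx.
wlog lt_ij : i j / i < j.
  by move=> W ri rj; case: (ltngtP i j) => // h; [|symmetry]; apply: W h _ _.
move=> ri rj; have le_jn : j <= n.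
  by rewrite leqNgt; apply/negP => /(run_le_Some rj)[c']; rewrite rSn.
have := @run_addn i j (n.+1 - j); rewrite subnKC ?leqW // rSn => e.
have [c' ] := @run_le_Some (i + (n.+1 - j)) n d rn ltac:(lia).
by rewrite e ?ri ?rj.
Qed.

End Exploration.

(** * Assembly of the four claims *)

Theorem theorem1 (R : realType) (V : finType) (E : rel V)
    (E_sym : symmetric E) (E_irr : irreflexive E)
    (pos : V -> R * R) (pos_drawing : straight_line_drawing E pos)
    (k : nat) (k_gt0 : (0 < k)%N)
    (v : V) (e0 : arc_type V) (e0_arc : E (atail e0) (ahead e0))
    (e0_tail : atail e0 = v) :
  [/\ forall i c, run E pos v k e0 i = Some c ->
        is_path_graph (occupied (pebbles c))
          (induced E (occupied (pebbles c))) v (ahead (cur c)),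
      forall i j c c', i <> j ->
        run E pos v k e0 i = Some c -> run E pos v k e0 j = Some c' ->
        state c <> state c',
      terminates E pos v k e0 &
      forall u, in_ball E k v u ->
        exists i c, run E pos v k e0 i = Some c /\ u \in occupied (pebbles c)].
Proof.
have wf_run := wf_run E_sym E_irr k_gt0 e0_arc e0_tail.
have [term cov] :=
  run_terminates_and_covers pos E_sym E_irr k_gt0 e0_arc e0_tail.
split=> //.
- move=> i c /wf_run/wf_stack[l [ip -> ->]].
  by rewrite (occupied_stack _ ip); apply: ipath_is_path_graph.
- move=> i j c c' neq_ij ri rj.
  move=> /(wf_state_inj (wf_run _ _ _ _ ri) (wf_run _ _ _ _ rj)) ec.
  by apply: neq_ij; apply: run_inj ri _; rewrite ?ec.
move=> u [d [[s walk_s <-] s_min] le_k].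
have ip := shortest_walk_ipath E_sym walk_s s_min.
(* [le_k] bounds the length of the walk; [u :: s] has one vertex more, so this is convertible to the
   required bound by [k.+1]. *)
have [c [i ri] pc] := cov _ ip le_k.
by exists i, c; rewrite pc (occupied_stack _ ip) in_set mem_head.
Qed.
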